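(* On the two-element set $\mathbf{2}=\{0,1\}$, consider the two binary relations ${\le}=\{(0,0),(0,1),(1,1)\}$ and ${\ne}=\{(0,1),(1,0)\}$. The intersection $\operatorname{pPol}(\ne)\cap\operatorname{pPol}(\le)$ of the two (finitely generated, maximal) partial clones $\operatorname{pPol}(\ne)$ and $\operatorname{pPol}(\le)$ is not a finitely generated partial clone on $\mathbf{2}$.
   Context: Let $A$ be a finite set with at least two elements. For $n\ge 1$, an $n$-ary partial function on $A$ is a map $f:\operatorname{dom}(f)\to A$ with $\operatorname{dom}(f)\subseteq A^n$; $\operatorname{Par}^{(n)}(A)$ is the set of all of these and $\operatorname{Par}(A)=\bigcup_{n\ge1}\operatorname{Par}^{(n)}(A)$. For $f\in\operatorname{Par}^{(n)}(A)$ and $g_1,\dots,g_n\in\operatorname{Par}^{(m)}(A)$, the composition $h=f[g_1,\dots,g_n]\in\operatorname{Par}^{(m)}(A)$ has domain $\{\vec a\in A^m : \vec a\in\bigcap_{i=1}^n\operatorname{dom}(g_i)\text{ and }(g_1(\vec a),\dots,g_n(\vec a))\in\operatorname{dom}(f)\}$ and is defined there by $h(\vec a)=f(g_1(\vec a),\dots,g_n(\vec a))$. The projection $e_i^n$ ($1\le i\le n$) is the total function $A^n\to A$, $(a_1,\dots,a_n)\mapsto a_i$. A partial clone on $A$ is a subset of $\operatorname{Par}(A)$ that contains all projections and is closed under composition. For $F\subseteq\operatorname{Par}(A)$, $\langle F\rangle$ is the smallest partial clone containing $F$. A partial clone $C$ is finitely generated if $C=\langle F\rangle$ for some finite set $F\subseteq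 C$. A maximal partial clone on $A$ is a partial clone $C\subsetneq\operatorname{Par}(A)$ such that no partial clone lies strictly between $C$ and $\operatorname{Par}(A)$. For an $h$-ary relation $\rho\subseteq A^h$, an $n$-ary partial function $f$ preserves $\rho$ if for every $h\times n$ matrix $M$ over $A$ all of whose columns belong to $\rho$ and all of whose rows $M_{1*},\dots,M_{h*}$ belong to $\operatorname{dom}(f)$, we have $(f(M_{1*}),\dots,f(M_{h*}))\in\rho$. The set $\operatorname{pPol}(\rho)$ of all $f\in\operatorname{Par}(A)$ preserving $\rho$ is a partial clone. It is known from earlier literature (Freivald, Lau) that $\operatorname{pPol}(\le)$ and $\operatorname{pPol}(\ne)$ are finitely generated maximal partial clones on $\mathbf{2}$. *)

(* Defs.v *)
From mathcomp Require Import all_boot all_order all_algebra.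
From mathcomp Require Import boolp classical_sets cardinality.

Set Implicit Arguments.
Unset Strict Implicit.
Unset Printing Implicit Defensive.

Local Open Scope classical_set_scope.

(* [f a = None] means that [a] is outside the domain of [f]. *)
Definition pfun (A : finType) (n : nat) := {ffun n.-tuple A -> option A}.

(* Arities are positive: the tag [n] carries the functions of arity [n.+1]. *)
Definition Par (A : finType) := {n : nat & pfun A n.+1}.

Definition to_Par (A : finType) (n : nat) (f : pfun A n.+1) : Par A :=
  Tagged (fun n => pfun A n.+1) f.

Definition pproj (A : finType) (n : nat) (i : 'I_n) : pfun A n :=
  [ffun a : n.-tuple A => Some (tnth a i)].

(* The tuple [b] of the values [g i a] is unique, and it exists exactly when
   [a] is in the domain of every [g i]; see [pcompP]. *)
Definition pcomp (A : finType) (n m : nat)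
    (f : pfun A n) (g : 'I_n -> pfun A m) : pfun A m :=
  [ffun a : m.-tuple A =>
     obind f [pick b : n.-tuple A | [forall i, g i a == Some (tnth b i)]]].

Lemma pcompP (A : finType) (n m : nat) (f : pfun A n) (g : 'I_n -> pfun A m)
    (a : m.-tuple A) (c : A) :
  pcomp f g a = Some c <->
  exists2 b : n.-tuple A, (forall i, g i a = Some (tnth b i)) & f b = Some c.
Proof.
rewrite /pcomp ffunE; case: pickP => [b /forallP gb|nob] /=.
  have {}gb i : g i a = Some (tnth b i) by apply/eqP.
  split=> [fb|[b' gb' <-]]; first by exists b.
  by congr (f _); apply: eq_from_tnth => i; apply: Some_inj; rewrite -gb -gb'.
split=> // -[b gb _]; move: (nob b) => /negP[].
by apply/forallP => i; rewrite gb.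
Qed.

Definition partial_clone (A : finType) (C : set (Par A)) : Prop :=
  (forall (n : nat) (i : 'I_n.+1), C (to_Par (pproj A i))) /\
  (forall (n m : nat) (f : pfun A n.+1) (g : 'I_n.+1 -> pfun A m.+1),
     C (to_Par f) -> (forall i, C (to_Par (g i))) -> C (to_Par (pcomp f g))).

(* [smallest] is the intersection of all partial clones containing [F]. *)
Definition pclone_gen (A : finType) (F : set (Par A)) : set (Par A) :=
  smallest (@partial_clone A) F.

Lemma partial_clone_gen (A : finType) (F : set (Par A)) :
  partial_clone (pclone_gen F).
Proof.
split=> [n i D [[Dp _] _] | n m f g Cf Cg D DF]; first exact: Dp.
by apply: DF.1.2 => [|i]; [exact: Cf | exact: Cg].
Qed.

Definition finitely_generated (A : finType) (C : set (Par A)) : Prop :=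
  exists F : set (Par A), [/\ finite_set F, F `<=` C & C = pclone_gen F].

(* [b] is the column of values of [f] at the rows of [M]; such a [b] exists
   exactly when all the rows of [M] are in the domain of [f]. *)
Definition preserves (A : finType) (h n : nat)
    (rho : {set h.-tuple A}) (f : pfun A n) : Prop :=
  forall (M : 'M[A]_(h, n)) (b : h.-tuple A),
    (forall j : 'I_n, [tuple M i j | i < h] \in rho) ->
    (forall i : 'I_h, f [tuple M i j | j < n] = Some (tnth b i)) ->
    b \in rho.

Definition pPol (A : finType) (h : nat) (rho : {set h.-tuple A}) :
    set (Par A) :=
  [set f : Par A | preserves rho (projT2 f)].

Lemma partial_clone_pPol (A : finType) (h : nat) (rho : {set h.-tuple A}) :
  partial_clone (pPol rho).
Proof.
split=> [n i M b Mrho Mb | n m f g pf pg M b Mrho Mb].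
  rewrite -(_ : [tuple M k i | k < h] = b) //.
  apply: eq_from_tnth => k; move: (Mb k).
  by rewrite /= ffunE !tnth_mktuple => -[].
have /choice[B BP] (i : 'I_h) : exists c : n.+1.-tuple A,
    (forall j, g j [tuple M i k | k < m.+1] = Some (tnth c j)) /\
    f c = Some (tnth b i).
  by have /pcompP[c gc fc] := Mb i; exists c.
apply: (pf (\matrix_(i, j) tnth (B i) j)%R) => [j|i] /=.
  apply: (pg j M) => // i; rewrite tnth_mktuple mxE; exact: (BP i).1.
rewrite -(BP i).2; congr (f _).
by apply: eq_from_tnth => j; rewrite tnth_mktuple mxE.
Qed.

Lemma partial_cloneI (A : finType) (C D : set (Par A)) :
  partial_clone C -> partial_clone D -> partial_clone (C `&` D).
Proof.
move=> [Cp Cc] [Dp Dc]; split=> [n i | n m f g [Cf Df] CDg]; first by split.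
by split; [apply: Cc | apply: Dc] => // i; have [] := CDg i.
Qed.

(* The two-element set is [bool], with 0 = [false] and 1 = [true]. *)
Definition le2 : {set 2.-tuple bool} :=
  [set [tuple false; false]; [tuple false; true]; [tuple true; true]]%SET.

Definition ne2 : {set 2.-tuple bool} :=
  [set [tuple false; true]; [tuple true; false]]%SET.

(* Main.v *)
Require Import Defs.
From mathcomp Require Import all_boot all_order all_algebra.
From mathcomp Require Import boolp classical_sets cardinality.

Set Implicit Arguments.
Unset Strict Implicit.
Unset Printing Implicit Defensive.

Local Open Scope classical_set_scope.

(** The obstruction lies in the domains.  Let [0 = (0, ..., 0)] and let [e_j]
    be the [j]-th unit vector of [{0,1}^n].  If [F] is a total monotone
    self-dual function, then [F 0 = 0], because [F 0 <= F (~ 0) = ~ F 0], and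
    [F e_j = 1] for at most one [j]: it forces [F (~ e_j) = 0], whereas
    [e_l <= ~ e_j] for [l <> j].  Hence fewer than [n] such functions cannot
    separate [0] from all the unit vectors ([few_sdmono_confuse_zero]).  So if
    [h] has arity less than [n], and total monotone self-dual functions of
    arity [n] are substituted in it, the result cannot be undefined at [0]
    alone.

    The monotone self-dual partial functions [h] of any arity for which no such
    substitution has domain exactly [{0,1}^n \ {0}] form a partial clone
    ([partial_clone_nonpuncturing]).  Indeed, if [f[g_1, ..., g_p]] has that
    domain after the substitution, then each [g_i] is defined there at least on
    [{0,1}^n \ {0}], hence everywhere if it has the property itself.  The [g_i]
    thus become total monotone self-dual functions of arity [n], and
    substituting these in [f] gives the forbidden domain.

    If finitely many functions generated all the monotone self-dual partial
    functions, then for [n] above all their arities every such function would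
    be in that partial clone.  But the first projection restricted to
    [{0,1}^n \ {0}] is monotone and self-dual, and is not in it. *)

(** * Monotone and self-dual functions *)

Definition le_tuple n (a b : n.-tuple bool) :=
  forall i, tnth a i -> tnth b i.

Definition neg_tuple n (a : n.-tuple bool) : n.-tuple bool :=
  [tuple ~~ tnth a i | i < n].

Lemma mem_le2 (u v : bool) : ([tuple u; v] \in le2) = (u ==> v).
Proof. by rewrite !inE -!val_eqE /=; case: u v => [] []. Qed.

Lemma mem_ne2 (u v : bool) : ([tuple u; v] \in ne2) = (v == ~~ u).
Proof. by rewrite !inE -!val_eqE /=; case: u v => [] []. Qed.

Lemma tuple2E (A : Type) (b : 2.-tuple A) :
  b = [tuple tnth b ord0; tnth b ord_max].
Proof. by case/tupleP: b => x b; case/tupleP: b => y b; rewrite tuple0. Qed.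

Lemma mktuple2 (A : Type) (F : 'I_2 -> A) :
  [tuple F i | i < 2] = [tuple F ord0; F ord_max].
Proof. by rewrite [LHS]tuple2E !tnth_mktuple. Qed.

(** Replaces the matrix by its two rows [a] and [b], the form in which
    monotonicity and self-duality are usually stated. *)
Lemma preserves2P (A : finType) n (rho : {set 2.-tuple A}) (f : pfun A n) :
  preserves rho f <->
  forall (a b : n.-tuple A) u v,
    (forall j, [tuple tnth a j; tnth b j] \in rho) ->
    f a = Some u -> f b = Some v -> [tuple u; v] \in rho.
Proof.
split=> [pf a b u v ab fa fb | pf M b Mrho Mb].
  pose M : 'M[A]_(2, n) :=
    (\matrix_(i, j) if i == ord0 then tnth a j else tnth b j)%R.
  have rowM (i : 'I_2) :
      [tuple M i j | j < n] = (if i == ord0 then a else b).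
    by apply: eq_from_tnth => j; rewrite tnth_mktuple mxE; case: ifP.
  apply: (pf M) => [j|i]; first by rewrite mktuple2 !mxE; exact: ab.
  rewrite rowM; case: ifP => [/eqP -> //|i0].
  by have -> : i = ord_max by apply: val_inj; case: i i0 => -[|[|]].
rewrite [b]tuple2E; apply: pf (Mb ord0) (Mb ord_max) => j.
by have := Mrho j; rewrite mktuple2 !tnth_mktuple.
Qed.

Lemma preserves_le2P n (f : pfun bool n) :
  preserves le2 f <->
  forall a b (u v : bool),
    le_tuple a b -> f a = Some u -> f b = Some v -> u -> v.
Proof.
rewrite preserves2P; split=> pf a b u v ab fa fb.
  apply/implyP; rewrite -mem_le2; apply: pf fa fb => j.
  by rewrite mem_le2; apply/implyP; exact: ab.
rewrite mem_le2; apply/implyP; apply: pf fa fb => j.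
by apply/implyP; rewrite -mem_le2.
Qed.

Lemma preserves_ne2P n (f : pfun bool n) :
  preserves ne2 f <->
  forall a u v, f a = Some u -> f (neg_tuple a) = Some v -> v = ~~ u.
Proof.
rewrite preserves2P; split=> [pf a u v fa fb | pf a b u v ab fa fb].
  apply/eqP; rewrite -mem_ne2; apply: pf fa fb => j.
  by rewrite mem_ne2 tnth_mktuple.
rewrite mem_ne2; apply/eqP; apply: pf (fa) _.
rewrite -fb; congr (f _); apply: eq_from_tnth => j; rewrite tnth_mktuple.
by have := ab j; rewrite mem_ne2 => /eqP.
Qed.

Definition sdmono n (F : n.-tuple bool -> bool) :=
  (forall a b, le_tuple a b -> F a -> F b) /\
  (forall a, F (neg_tuple a) = ~~ F a).

Lemma sdmono_tnth n (i : 'I_n) : sdmono (fun a => tnth a i).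
Proof. by split=> [a b ab | a]; [exact: ab | rewrite tnth_mktuple]. Qed.

(** * Separating zero from the unit vectors *)

Definition zero_tuple n : n.-tuple bool := [tuple false | i < n].

Definition unit_tuple n (j : 'I_n) : n.-tuple bool := [tuple i == j | i < n].

Lemma unit_tuple_neq0 n (j : 'I_n) : unit_tuple j <> zero_tuple n.
Proof. by move/(congr1 (@tnth _ _ ^~ j)); rewrite !tnth_mktuple eqxx. Qed.

Lemma sdmono_zero n (F : n.-tuple bool -> bool) :
  sdmono F -> F (zero_tuple n) = false.
Proof.
move=> [Fmono Fsd]; apply/negP => F0.
suff: F (neg_tuple (zero_tuple n)) by rewrite Fsd F0.
by apply: Fmono F0 => i; rewrite tnth_mktuple.
Qed.

Lemma sdmono_unit_inj n (F : n.-tuple bool -> bool) (j l : 'I_n) :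
  sdmono F -> F (unit_tuple j) -> F (unit_tuple l) -> j = l.
Proof.
move=> [Fmono Fsd] Fj Fl; apply/eqP/negPn/negP => jl.
suff: F (neg_tuple (unit_tuple j)) by rewrite Fsd Fj.
apply: Fmono Fl => i; rewrite !tnth_mktuple => /eqP ->.
by rewrite eq_sym.
Qed.

(** The witness is a unit vector that every [F i] sends to [0].  Without one,
    choosing for each [j] some [F i] that is [1] at [e_j] would be an injection
    of ['I_n] into ['I_m], by [sdmono_unit_inj]. *)
Lemma few_sdmono_confuse_zero m n (F : 'I_m -> n.-tuple bool -> bool) :
  m < n -> (forall i, sdmono (F i)) ->
  exists2 a, a <> zero_tuple n & forall i, F i a = F i (zero_tuple n).
Proof.
move=> mn sdF.
have [/forallP sep | /forallPn[j /existsPn Fj]] :=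
    boolP [forall j : 'I_n, [exists i, F i (unit_tuple j)]].
  have /choice[c cP] (j : 'I_n) : exists i, F i (unit_tuple j).
    by apply/existsP.
  have c_inj : injective c.
    move=> j l cjl; apply: (sdmono_unit_inj (F := F (c j))) => //.
    by rewrite cjl.
  by have := leq_card c c_inj; rewrite !card_ord leqNgt mn.
exists (unit_tuple j) => [|i]; first exact: unit_tuple_neq0.
by rewrite sdmono_zero //; apply/negbTE/Fj.
Qed.

(** * Functions that never puncture the cube *)

(** Substituting only the projections would describe the domain of [h], but
    not pass to compositions: there, the inner functions turn into arbitrary
    total monotone self-dual functions fed to the outer one. *)
Definition punctures m n (h : pfun bool m)
    (F : 'I_m -> n.-tuple bool -> bool) :=
  forall a, h [tuple F i a | i < m] = None <-> a = zero_tuple n.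

Definition nonpuncturing n : set (Par bool) :=
  [set h : Par bool | [/\ preserves ne2 (projT2 h), preserves le2 (projT2 h) &
    forall F : 'I_(projT1 h).+1 -> n.-tuple bool -> bool,
      (forall i, sdmono (F i)) -> ~ punctures (projT2 h) F]].

Lemma pcomp_total (A : finType) n m (f : pfun A n) (g : 'I_n -> pfun A m)
    (a : m.-tuple A) (b : n.-tuple A) :
  (forall i, g i a = Some (tnth b i)) -> Defs.pcomp f g a = f b.
Proof.
move=> gb; case fb: (f b) => [c|]; first by apply/pcompP; exists b.
case E: (Defs.pcomp f g a) => [c|//].
have /pcompP[b' gb' fb'] := E.
suff bb' : b = b' by rewrite bb' fb' in fb.
by apply: eq_from_tnth => i; apply: Some_inj; rewrite -gb -gb'.
Qed.

Lemma partial_clone_nonpuncturing n : partial_clone (nonpuncturing n).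
Proof.
have [ne_proj ne_comp] := partial_clone_pPol ne2.
have [le_proj le_comp] := partial_clone_pPol le2.
split=> [m i | p m f g [fne fle fnp] gC].
  split; [exact: ne_proj | exact: le_proj |].
  by move=> F sdF /(_ (zero_tuple n))[_ /(_ erefl)]; rewrite /= ffunE.
have gne i : pPol ne2 (to_Par (g i)) by case: (gC i).
have gle i : pPol le2 (to_Par (g i)) by case: (gC i).
split; [exact: ne_comp | exact: le_comp |] => F sdF punct.
pose Fa a := [tuple F i a | i < m.+1].
have gdef i a : a <> zero_tuple n -> g i (Fa a) <> None.
  move=> a0; case E: (Defs.pcomp f g (Fa a)) => [c|]; last by have /punct := E.
  by have /pcompP[b gb _] := E; rewrite gb.
(* As [g i] does not puncture the cube, it must be defined at [0] as well. *)
have gtot i a : exists c, g i (Fa a) = Some c.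
  case E: (g i (Fa a)) => [c|]; first by exists c.
  have [_ _ gnp] := gC i; case: (gnp F sdF) => b; split=> [gb | ->].
    by have [//|/eqP b0] := eqVneq b (zero_tuple n); case: (gdef i b b0).
  by have [<-|/eqP a0] := eqVneq a (zero_tuple n); last by case: (gdef i a a0).
have /choice[G GP] i : exists G, forall a, g i (Fa a) = Some (G a).
  by have [G GP] := choice (gtot i); exists G.
have sdG i : sdmono (G i).
  have /preserves_ne2P gnei := gne i; have /preserves_le2P glei := gle i.
  split=> [a b ab | a].
    apply: glei (GP i a) (GP i b) => j; rewrite !tnth_mktuple.
    exact: (sdF j).1.
  apply: gnei (GP i a) _; rewrite -GP; congr (g i _).
  by apply: eq_from_tnth => j; rewrite !tnth_mktuple (sdF j).2.
apply: (fnp G sdG) => a.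
rewrite -punct /= -/(Fa a).
rewrite (@pcomp_total _ _ _ _ _ _ [tuple G i a | i < p.+1]) //.
by move=> i; rewrite tnth_mktuple.
Qed.

(** The tuple given by [few_sdmono_confuse_zero] has the same image as [0]
    under the substitution, so it is outside the domain as soon as [0] is. *)
Lemma small_arity_nonpuncturing n (h : Par bool) :
  (projT1 h).+1 < n -> (pPol ne2 `&` pPol le2) h -> nonpuncturing n h.
Proof.
move=> hn [hne hle]; split=> // F sdF punct.
have [a a0 aE] := few_sdmono_confuse_zero hn sdF.
apply/a0/punct; rewrite (eq_mktuple _ aE).
exact/punct.
Qed.

(** * The punctured projection *)

Definition punctured_proj n : pfun bool n.+1 :=
  [ffun a => if a == zero_tuple n.+1 then None else Some (tnth a ord0)].

Lemma punctured_proj_Some n (a : n.+1.-tuple bool) u :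
  punctured_proj n a = Some u -> u = tnth a ord0.
Proof. by rewrite ffunE; case: ifP => // _ [<-]. Qed.

Lemma punctured_proj_pPol n :
  (pPol ne2 `&` pPol le2) (to_Par (punctured_proj n)).
Proof.
split; [apply/preserves_ne2P => a u v | apply/preserves_le2P => a b u v ab].
  by move=> /punctured_proj_Some -> /punctured_proj_Some ->;
    rewrite tnth_mktuple.
by move=> /punctured_proj_Some -> /punctured_proj_Some ->; exact: ab.
Qed.

Lemma punctured_proj_puncturing n :
  ~ nonpuncturing n.+1 (to_Par (punctured_proj n)).
Proof.
case=> _ _ /(_ (fun i a => tnth a i) (@sdmono_tnth _))[] a /=.
have -> : [tuple tnth a i | i < n.+1] = a.
  by apply: eq_from_tnth => i; rewrite tnth_mktuple.
by rewrite ffunE; case: eqP.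
Qed.

Theorem theorem5 : ~ finitely_generated (pPol ne2 `&` pPol le2).
Proof.
move=> [S [/finite_seqP[s ->] sC CE]].
(* The element [h] has arity [(projT1 h).+1], so that [N.+2] exceeds all the
   arities that occur in [s]. *)
pose N := \max_(h <- s) projT1 h.
apply: (@punctured_proj_puncturing N.+1).
have := @punctured_proj_pPol N.+1; rewrite {1}CE; apply; split.
  exact: partial_clone_nonpuncturing.
move=> h hs; apply: small_arity_nonpuncturing; last exact: sC.
rewrite 2!ltnS.
exact: (@leq_bigmax_seq _ _ xpredT (fun h : Par bool => projT1 h)).
Qed.
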